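(* Let $n \geq 5$ be an odd integer. Then Player $A$ has a winning strategy in the game $Z(n,d)$ for every $d \in \left\{\frac{n-1}{2}, \frac{n+1}{2}, n, n+1, n+2\right\}$.
   Context: For integers $n \geq 4$ and $d \geq 2$, $Z(n,d)$ is the following two-player game. Initially the board contains the numbers $1,2,\dots,n$. Players $A$ and $B$ alternately cross out (remove) one number from the board, with $A$ moving first, until exactly two numbers remain. If the sum of the two remaining numbers is divisible by $d$, $A$ wins; otherwise $B$ wins. A player has a winning strategy if that player can force a win regardless of the opponent's moves. *)

(* Defs.v *)
From mathcomp Require Import all_boot.

Set Implicit Arguments.
Unset Strict Implicit.
Unset Printing Implicit Defensive.

(* A position of Z(n, d) is given by its history: the numbers crossed out so
   far, in chronological order. *)
Definition board (n : nat) (h : seq nat) : seq nat :=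
  [seq x <- iota 1 n | x \notin h].

Definition legal_history (n : nat) (h : seq nat) : Prop :=
  [/\ uniq h, {subset h <= iota 1 n} & size h <= n - 2].

Definition game_over (n : nat) (h : seq nat) : Prop := size (board n h) = 2.

(* Only meaningful when the game is over; the sum then has two terms. *)
Definition A_wins (n d : nat) (h : seq nat) : Prop := d %| sumn (board n h).

Definition A_to_move (h : seq nat) : bool := ~~ odd (size h).

Definition strategy := seq nat -> nat.

Definition A_follows (s : strategy) (h : seq nat) : Prop :=
  forall i, i < size h -> A_to_move (take i h) -> nth 0 h i = s (take i h).

(* The first clause forbids illegal moves: without it, a strategy that gets
   stuck would win vacuously. *)
Definition A_winning_strategy (n d : nat) (s : strategy) : Prop :=
  (forall h, legal_history n h -> A_follows s h ->
     ~ game_over n h -> A_to_move h -> s h \in board n h) /\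
  (forall h, legal_history n h -> A_follows s h ->
     game_over n h -> A_wins n d h).

Definition A_has_winning_strategy (n d : nat) : Prop :=
  exists s : strategy, A_winning_strategy n d s.

(* Main.v *)
(** Since [n] is odd, [A] makes both the first and the last move. It therefore
    suffices that, after crossing out some number [a], the other numbers can be
    matched in pairs whose sum is divisible by [d]: [A] starts with [a] and then
    always crosses out the partner of [B]'s last choice, so that the two
    survivors are partners. The matchings are
    - [x <-> n + 1 - x] with [a = (n + 1) / 2], for [n + 1] and [(n + 1) / 2];
    - [x <-> n - x] with [a = n], for [n];
    - [x <-> n + 2 - x] with [a = 1], for [n + 2];
    - [x <-> 2 m - x] and [m <-> 2 m] with [a = n], for [m = (n - 1) / 2]. *)
Require Import Defs.
From mathcomp Require Import all_boot.
From mathcomp Require Import zify.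

Set Implicit Arguments.
Unset Strict Implicit.
Unset Printing Implicit Defensive.

Lemma mem_board n h x : (x \in board n h) = (x \notin h) && (0 < x <= n).
Proof. by rewrite mem_filter mem_iota add1n ltnS. Qed.

Lemma size_board n h :
  uniq h -> {subset h <= iota 1 n} -> size (board n h) + size h = n.
Proof.
move=> Uh sub_h.
have /perm_size <- : perm_eq [seq x <- iota 1 n | x \in h] h.
  apply: uniq_perm => [||x]; rewrite ?filter_uniq ?iota_uniq //.
  by rewrite mem_filter andb_idr // => /sub_h.
by rewrite addnC !size_filter count_predC size_iota.
Qed.

Lemma A_follows_rcons s h x :
  A_follows s (rcons h x) ->
  A_follows s h /\ (A_to_move h -> x = s h).
Proof.
move=> fol; split=> [i lt_ih|].
  have := fol i; rewrite size_rcons nth_rcons lt_ih -cats1 takel_cat ?(ltnW lt_ih) //.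
  by apply; apply: ltnW.
have := fol (size h).
by rewrite size_rcons nth_rcons ltnn eqxx -cats1 take_size_cat //; apply.
Qed.

Definition pairing_strategy (a : nat) (p : nat -> nat) : strategy :=
  fun h => if h is [::] then a else p (last 0 h).

Definition pairing (n d a : nat) (p : nat -> nat) : Prop :=
  forall x, 0 < x <= n -> x != a ->
    [/\ 0 < p x <= n, p x != a, p x != x, p (p x) = x & d %| x + p x].

(** Odd size means that [A] has just moved. Each full round adds some [x] chosen by [B] and then the
    reply [p x], so an induction removing two moves at a time preserves closure under [p]. *)
Lemma pairing_strategy_closed n d a p (h : seq nat) :
  pairing n d a p ->
  uniq h -> {subset h <= iota 1 n} -> A_follows (pairing_strategy a p) h ->
  odd (size h) ->
  a \in h /\ forall x, x \in h -> x != a -> p x \in h.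
Proof.
move=> pP; have [m] := ubnP (size h); elim: m h => // m IHm h.
case/lastP: h => // h y; case/lastP: h => [|h x].
  move=> _ _ _ /(A_follows_rcons (h := [::])) [_ /(_ isT) /= ->] _.
  by split=> [|x]; rewrite ?inE ?eqxx // => ->.
rewrite !size_rcons /= negbK => le_hm.
rewrite !rcons_uniq mem_rcons inE => /and3P[_ xh Uh] sub_h.
case/A_follows_rcons=> /A_follows_rcons[fol _] folx odd_h.
have {folx} -> : y = p x.
  rewrite folx /A_to_move ?size_rcons /= ?negbK //.
  by case: h {le_hm xh Uh sub_h fol folx odd_h} => //= z h; rewrite last_rcons.
have sub' : {subset h <= iota 1 n}.
  by move=> z zh; apply: sub_h; rewrite !(mem_rcons, inE) zh !orbT.
have lt_hm : size h < m by exact: leq_trans (leqnSn _) le_hm.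
have [ah clo] := IHm h lt_hm Uh sub' fol odd_h.
have x_n : 0 < x <= n.
  by rewrite -[_ <= n]ltnS -add1n -mem_iota sub_h // !(mem_rcons, inE) eqxx orbT.
(* [a] was crossed out at the start, so [B] cannot choose it again. *)
have xa : x != a by apply: contraNneq xh => ->.
have [_ _ _ ppx _] := pP x x_n xa.
split=> [|z]; rewrite !(mem_rcons, inE) ?ah ?orbT //.
case/or3P=> [/eqP->|/eqP->|zh za]; first by rewrite ppx eqxx orbT.
  by rewrite eqxx.
by rewrite clo ?orbT.
Qed.

Lemma pairing_A_wins n d a p :
  odd n -> 0 < a <= n -> pairing n d a p -> A_has_winning_strategy n d.
Proof.
move=> odd_n a_n pP; exists (pairing_strategy a p); split.
  move=> h [Uh sub_h _] fol _; rewrite mem_board /A_to_move.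
  case/lastP: h Uh sub_h fol => [|h x] //.
  rewrite rcons_uniq => /andP[xh Uh] sub_h /A_follows_rcons[fol _].
  rewrite size_rcons /= negbK => odd_h.
  have sub' : {subset h <= iota 1 n}.
    by move=> z zh; apply: sub_h; rewrite mem_rcons inE zh orbT.
  have [ah clo] := pairing_strategy_closed pP Uh sub' fol odd_h.
  have x_n : 0 < x <= n.
    by rewrite -[_ <= n]ltnS -add1n -mem_iota sub_h // mem_rcons inE eqxx.
  have xa : x != a by apply: contraNneq xh => ->.
  have [px_n pxa pxx ppx _] := pP x x_n xa.
  have -> : pairing_strategy a p (rcons h x) = p x.
    by case: h {xh Uh sub_h fol odd_h sub' ah clo} => //= z h; rewrite last_rcons.
  rewrite px_n andbT mem_rcons inE (negPf pxx) /=.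
  (* The reply is legal: were [p x] already crossed out, closure would put [p (p x) = x] in [h]
     before [B] chose it. *)
  by apply: contra xh => /clo /(_ pxa); rewrite ppx.
move=> h [Uh sub_h _] fol over.
have odd_h : odd (size h).
  by move: odd_n; rewrite -(size_board Uh sub_h) over oddD.
have [ah clo] := pairing_strategy_closed pP Uh sub_h fol odd_h.
rewrite /A_wins; move: over (@mem_board n h); rewrite /game_over.
case: (board n h) => [|x [|y [|]]] //= _ memB.
have := memB x; rewrite inE eqxx => /esym/andP[xh x_n].
have xa : x != a by apply: contraNneq xh => ->.
have [px_n pxa pxx ppx dvd] := pP x x_n xa.
(* The partner of a survivor [x] also survives and differs from [x], so it is the other survivor
   [y]. *)
have := memB (p x); rewrite px_n andbT !inE (negPf pxx) /=.
have -> : p x \notin h by apply: contra xh => /clo /(_ pxa); rewrite ppx.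
by move=> /eqP <-; rewrite addn0.
Qed.

(** Lets the matching for [n + 1] serve for [(n + 1) %/ 2] as well. *)
Lemma pairing_dvd n d e a p : d %| e -> pairing n e a p -> pairing n d a p.
Proof.
move=> de pP x x_n xa; have [? ? ? ? ex] := pP x x_n xa.
by split=> //; apply: dvdn_trans ex.
Qed.

Lemma pairing_reflection n a e :
  (forall x, 0 < x <= n -> x != a ->
    [&& x < e, e - x <= n, e - x != a & e - x != x]) ->
  pairing n e a (subn e).
Proof.
move=> H x x_n xa; have /and4P[lt_xe le_n ea ex] := H x x_n xa.
by split=> //; rewrite ?subn_gt0 ?lt_xe // ?subKn ?subnKC // ltnW.
Qed.

(** Reflection in [m] fixes [m] and sends [m.*2] to 0, which is off the board; these two leftovers
    are matched with each other, with sum [3 * m]. All other pairs sum to [m.*2]. *)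
Lemma pairing_half m :
  1 < m ->
  pairing m.*2.+1 m m.*2.+1
    (fun x => if x == m then m.*2 else if x == m.*2 then m else m.*2 - x).
Proof.
move=> m1 x x_n xa.
case: (x =P m) => [->|xm].
  by rewrite eqxx ifN; [split; try lia; rewrite -mul2n dvdn_add ?dvdn_mull | lia].
case: (x =P m.*2) => [->|x2m].
  by rewrite eqxx; split; try lia; rewrite -mul2n dvdn_add ?dvdn_mull.
rewrite !ifN; try lia.
by split; try lia; rewrite subnKC -?mul2n ?dvdn_mull //; lia.
Qed.

Theorem theorem3p1p4 (n : nat) (hn : 5 <= n) (hodd : odd n) (d : nat)
    (hd : d \in [:: (n - 1) %/ 2; (n + 1) %/ 2; n; n + 1; n + 2]) :
  A_has_winning_strategy n d.
Proof.
have nE : n = (n./2).*2.+1 by rewrite -[LHS]odd_double_half hodd.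
have middle : pairing n (n + 1) n./2.+1 (subn (n + 1)).
  by apply: pairing_reflection => x x_n xa; lia.
move: hd; rewrite !inE => /or4P[/eqP->|/eqP->|/eqP->|/orP[/eqP->|/eqP->]].
- have -> : (n - 1) %/ 2 = n./2 by lia.
  apply: (pairing_A_wins (a := n) hodd); first lia.
  (* The occurrence of [n] inside [n./2] is left alone, since [n./2] plays the role of [m]. *)
  by rewrite {1 3}nE; apply: pairing_half; lia.
- apply: (pairing_A_wins hodd _ (pairing_dvd _ middle)); first lia.
  (* As [n] is odd, [n + 1] is exactly twice [(n + 1) %/ 2]. *)
  by apply/dvdnP; exists 2; lia.
- apply: (pairing_A_wins (a := n) hodd); first lia.
  by apply: pairing_reflection => x x_n xa; lia.
- by apply: (pairing_A_wins hodd _ middle); lia.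
- apply: (pairing_A_wins (a := 1) hodd); first lia.
  by apply: pairing_reflection => x x_n xa; lia.
Qed.
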